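(* Let $q$ be a prime power, let $\mathbb{F}_q$ be the field with $q$ elements, let $d \ge 4$, and let $a_1,\ldots,a_d \in \mathbb{F}_q\setminus\{0\}$ satisfy $a_1+\cdots+a_d = 0$. There exists a constant $c_q < q$ such that for all sufficiently large $n$, every set $A \subset \mathbb{F}_q^n$ with $|A| > c_q^n$ contains pairwise distinct elements $x_1,\ldots,x_d \in A$ satisfying \[ a_1x_1 + a_2x_2 + \cdots + a_dx_d = 0. \] *)

(* Defs.v *)
From HB Require Import structures.
From mathcomp Require Export all_boot all_order all_algebra all_field.
From mathcomp Require Export reals.

(* Main.v *)
(* Slice rank (Ellenberg-Gijswijt, Tao) handles three coefficients: a set
   without nontrivial solutions of [a x + b y + c z = 0] has at most
   [3 c_q ^ n] elements.  Longer equations are shortened.  Split the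
   coefficients into two parts of sums [s] and [- s] with [s != 0], and look
   for a pivot [x] such that both parts solve to a multiple of [x]; each half
   is a shorter equation whose extra coefficient is [- s] or [s].  The two
   partial solutions must not share a variable: if for every pivot in a large
   set [B] each solution of the second half were blocked by a bounded set
   [H x], then an independent set of the digraph [x -> H x] inside [B] would
   have no solution of the second half at all.  A two-element part of nonzero
   sum exists unless the characteristic is 2 and all coefficients are equal;
   then pigeonhole on sums of two elements settles length four, and
   three-element parts reduce longer equations to that. *)
Require Import Defs.
From mathcomp Require Import all_boot all_order all_algebra all_field.
From mathcomp Require Import reals boolp.
From mathcomp Require Import ring lra zify.
Import Order.TTheory GRing.Theory Num.Theory.
Local Open Scope ring_scope.

Set Implicit Arguments.
Unset Strict Implicit.
Unset Printing Implicit Defensive.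

(** * Linear algebra: slice rank of a diagonal tensor *)

(** The left kernel of [P] has dimension [N - \rank P], so that many columns of a basis [H] of it
    form an invertible block; a suitable combination of the rows of [H] is 1 on all these
    columns. *)
Lemma orthogonal_large_support (K : fieldType) (N m : nat) (P : 'M[K]_(N, m)) :
  exists h : 'rV[K]_N, h *m P = 0 /\
    exists2 f : 'I_(N - \rank P) -> 'I_N, injective f & forall j, h 0 (f j) = 1.
Proof.
rewrite -mxrank_ker; set r := \rank (kermx P).
pose H := row_base (kermx P).
have Hr : \rank H^T = r by rewrite mxrank_tr eq_row_base.
have full : row_full H^T by rewrite /row_full Hr.
have U := fullrowsub_unit full.
exists (const_mx 1 *m invmx (rowsub (fullrankfun full) H^T)^T *m H); split.
  have HP : H *m P = 0 by apply/sub_kermxP; rewrite eq_row_base.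
  by rewrite -(mulmxA _ H P) HP mulmx0.
exists (fullrankfun full); first exact: fullrankfun_inj.
move=> j; set B := rowsub _ _ in U *.
have UT : B^T \in unitmx by rewrite unitmx_tr.
have := mulmxKV UT (const_mx 1 : 'rV_r).
move/(congr1 (fun M : 'rV_r => M 0 j)); rewrite [RHS]mxE; apply: etrans.
by rewrite !mxE; apply: eq_bigr => k _; congr (_ * _); rewrite !mxE.
Qed.

(** Terms with the same [e t] share the column [v (e t)], so together they form a matrix of rank at
    most one. *)
Lemma mxrank_sum_le (K : fieldType) (T S : finType) (L : {set S}) (Q : pred T)
    (p q : nat) (e : T -> S) (v : S -> 'cV[K]_p) (g : T -> 'rV[K]_q) :
  (forall t, Q t -> e t \in L) ->
  (\rank (\sum_(t | Q t) v (e t) *m g t)%R <= #|L|)%N.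
Proof.
move=> QL; rewrite (partition_big e (mem L)) //=.
rewrite (eq_bigr (fun s => v s *m (\sum_(t | Q t && (e t == s)) g t))); last first.
  by move=> s _; rewrite mulmx_sumr; apply: eq_bigr => t /andP[_ /eqP ->].
rewrite -sum1_card; elim/big_ind2: _ => [|M m M' m' le le'|s _].
- by rewrite mxrank0.
- exact: leq_trans (mxrank_add _ _) (leq_add le le').
- exact: leq_trans (mxrankM_maxr _ _) (rank_leq_row _).
Qed.

(* The weights [h] kill every term whose first factor is indexed by [L]; summing
   over the first variable leaves [diag_mx h], of large rank because the support
   of [h] is large, but a sum of two matrices of rank at most [#|L|]. *)
Lemma slice_rank_diagonal (K : fieldType) (N : nat) (T S : finType)
    (L : {set S}) (c : T -> K) (e1 e2 e3 : T -> S) (u v w : S -> 'I_N -> K) :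
  (forall t, [|| e1 t \in L, e2 t \in L | e3 t \in L]) ->
  (forall i j k, \sum_t c t * u (e1 t) i * v (e2 t) j * w (e3 t) k
                 = ((i == j) && (j == k))%:R) ->
  (N <= 3 * #|L|)%N.
Proof.
move=> Lcov diag.
pose P : 'M[K]_(N, #|L|) := \matrix_(i, l) u (enum_val l) i.
have [h [hP [f finj hf]]] := orthogonal_large_support P.
have hu s : s \in L -> \sum_i h 0 i * u s i = 0.
  move=> sL; move/matrixP/(_ 0 (enum_rank_in sL s)): hP; rewrite !mxE; apply: etrans.
  by apply: eq_bigr => i _; rewrite mxE enum_rankK_in.
pose z t := c t * \sum_i h 0 i * u (e1 t) i.
pose col s : 'cV[K]_N := \col_j v s j.
pose row s : 'rV[K]_N := \row_k w s k.
(* Terms with [e1 t \notin L] are split by whether [e2 t] lies in [L]; if not, [e3 t] does, and the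
   transpose puts that factor on the left. *)
have dE : diag_mx h =
    \sum_(t | (e1 t \notin L) && (e2 t \in L)) col (e2 t) *m (z t *: row (e3 t))
  + (\sum_(t | (e1 t \notin L) && (e2 t \notin L))
      (row (e3 t))^T *m (z t *: (col (e2 t))^T))^T.
  rewrite raddf_sum /=.
  rewrite [X in _ + X](eq_bigr (fun t => col (e2 t) *m (z t *: row (e3 t)))); last first.
    by move=> t _; rewrite trmx_mul linearZ /= !trmxK -scalemxAr -scalemxAl.
  have -> (X : T -> 'M[K]_N) : \sum_(t | (e1 t \notin L) && (e2 t \in L)) X t
     + \sum_(t | (e1 t \notin L) && (e2 t \notin L)) X t = \sum_(t | e1 t \notin L) X t.
    by rewrite [RHS](bigID (fun t => e2 t \in L)).
  apply/matrixP=> j k; rewrite !mxE summxE.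
  transitivity (\sum_i h 0 i * ((i == j) && (j == k))%:R).
    rewrite (bigD1 j) //= eqxx big1 => [|i /negPf ->]; last by rewrite mulr0.
    by rewrite addr0 mulr_natr.
  under eq_bigr do rewrite -diag mulr_sumr.
  rewrite exchange_big /= (bigID (fun t => e1 t \in L)) /= big1 ?add0r.
    apply: eq_bigr => t _; rewrite !mxE big_ord1 !mxE /z.
    rewrite mulr_sumr !mulr_suml mulr_sumr.
    by apply: eq_bigr => i _; ring.
  move=> t /hu h0.
  rewrite (eq_bigr (fun i => h 0 i * u (e1 t) i * (c t * v (e2 t) j * w (e3 t) k))).
    by rewrite -mulr_suml h0 mul0r.
  by move=> i _; ring.
(* The rows and columns selected by [f] form an identity block of [diag_mx h]. *)
have rk : (N - \rank P <= \rank (diag_mx h))%N.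
  have sub1 : mxsub f f (diag_mx h) = 1%:M.
    by apply/matrixP=> i j; rewrite !mxE hf (inj_eq finj).
  rewrite -[X in (X <= _)%N](mxrank1 K) -sub1 -[X in mxsub _ _ X]mulmx1.
  rewrite mxsub_mul (leq_trans (mxrankM_maxl _ _)) //.
  by rewrite rowsubE mxrankM_maxr.
have le2 : (\rank (diag_mx h) <= #|L| + #|L|)%N.
  rewrite dE (leq_trans (mxrank_add _ _)) // leq_add //.
    by apply: (@mxrank_sum_le K T S L _ N N e2 col) => t /andP[].
  rewrite mxrank_tr; apply: (@mxrank_sum_le K T S L _ N N e3 (fun s => (row s)^T)).
  by move=> t /andP[/negPf n1 /negPf n2]; move: (Lcov t); rewrite n1 n2.
have := rank_leq_col P; lia.
Qed.

(** * The polynomial method for three coefficients *)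

(** Each choice of a variable in each of the [m] factors gives one monomial; the [unit] summand of
    [T] is the constant 1. Exponents live in ['I_m.+1] so that exponent vectors form a finite
    type. *)
Lemma power_sum_expansion (K : comNzRingType) (I : finType) (m : nat) (a : I -> K) :
  exists (T : finType) (c : T -> K) (e : T -> I -> 'I_m.+1),
    (forall t, \sum_i e t i <= m)%N /\
    forall x : I -> K,
      1 - (\sum_i a i * x i) ^+ m = \sum_t c t * \prod_i x i ^+ e t i.
Proof.
pose cnt (f : {ffun 'I_m -> I}) i := #|[set j | f j == i]|.
have cntK f i : (inord (cnt f i) : 'I_m.+1) = cnt f i :> nat.
  by rewrite inordK // ltnS (leq_trans (max_card _)) ?card_ord.
have prodE (f : {ffun 'I_m -> I}) (x : I -> K) : \prod_j x (f j) = \prod_i x i ^+ cnt f i.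
  rewrite (partition_big f predT) //=; apply: eq_bigr => i _.
  rewrite (eq_bigr (fun=> x i)) => [|j /eqP -> //].
  by rewrite prodr_const /cnt; congr (_ ^+ _); apply: eq_card => j; rewrite !inE.
pose T := (unit + {ffun 'I_m -> I})%type.
pose c (t : T) : K := if t is inr f then - \prod_j a (f j) else 1.
pose e (t : T) i : 'I_m.+1 := if t is inr f then inord (cnt f i) else ord0.
exists T, c, e; split.
  move=> t; case: t => [u|f] /=; first by rewrite big1.
  under eq_bigr do rewrite cntK.
  rewrite -[leqRHS]card_ord -sum1_card (partition_big f predT) //=.
  by apply: leq_sum => i _; rewrite sum1_card /cnt cardsE.
move=> x; rewrite big_sumType /= [in RHS](@big_pred1 _ _ _ _ tt) => [|[] //].
rewrite [in RHS]big1 // mulr1; congr (_ + _).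
rewrite -[X in _ ^+ X](card_ord m) -prodr_const.
rewrite (bigA_distr_bigA (fun _ i => a i * x i)) -sumrN; apply: eq_bigr => f _.
rewrite big_split /= (prodE f x) mulNr; congr (- (_ * _)).
by apply: eq_bigr => i _; rewrite cntK.
Qed.

Lemma finField_eq0_indicator (F : finFieldType) (x : F) :
  (x == 0)%:R = 1 - x ^+ #|F|.-1.
Proof.
have q1 := finNzRing_gt1 F.
case: eqVneq => [->|x0]; first by rewrite expr0n -subn1 subn_eq0 leqNgt q1 subr0.
apply/eqP; rewrite eq_sym subr_eq0 eq_sym -(inj_eq (mulfI x0)) -exprS prednK ?(ltnW q1) //.
by rewrite expf_card mulr1.
Qed.

Lemma prod_row_eq0 (K : comNzRingType) (n : nat) (v : 'rV[K]_n) :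
  \prod_(l < n) (v 0 l == 0)%:R = (v == 0)%:R :> K.
Proof.
case: eqVneq => [->|/rV0Pn[l vl]]; first by rewrite big1 // => l _; rewrite mxE eqxx.
by rewrite (bigD1 l) //= (negPf vl) mul0r.
Qed.

Definition low_degree (n m : nat) : {set {ffun 'I_n -> 'I_m.+1}} :=
  [set s : {ffun 'I_n -> 'I_m.+1} | (3 * \sum_l s l <= n * m)%N].

(** The product over coordinates of [1 - (\sum_i a i * x i) ^+ m] is the indicator of solutions,
    hence of the diagonal on [A]. Each of its monomials has degree at most [n * m], so one of the
    three vector variables receives at most a third of that. *)
Lemma card_trivial_solutions (F : finFieldType) (n : nat) (a : 'I_3 -> F)
    (A : {set 'rV[F]_n}) :
  \sum_i a i = 0 ->
  (forall x : 'I_3 -> 'rV[F]_n, (forall i, x i \in A) -> \sum_i a i *: x i = 0 ->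
     forall i j, x i = x j) ->
  (#|A| <= 3 * #|low_degree n #|F|.-1|)%N.
Proof.
move=> sa triv; set m := #|F|.-1.
have [T [c [e [ele eE]]]] := power_sum_expansion m a.
pose mon (s : {ffun 'I_n -> 'I_m.+1}) (i : 'I_#|A|) := \prod_l enum_val i 0 l ^+ s l.
pose ex k (t : {ffun 'I_n -> T}) := [ffun l => e (t l) k].
pose o1 : 'I_3 := lift ord0 ord0; pose o2 : 'I_3 := lift ord0 (lift ord0 ord0).
have sum3 (V : nmodType) (X : 'I_3 -> V) : \sum_i X i = X ord0 + X o1 + X o2.
  by rewrite !big_ord_recl big_ord0 addr0 addrA.
have prod3 (X : 'I_3 -> F) : \prod_i X i = X ord0 * X o1 * X o2.
  by rewrite !big_ord_recl big_ord0 mulr1 mulrA.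
have sum3n (X : 'I_3 -> nat) : (\sum_i X i = X ord0 + X o1 + X o2)%N.
  by rewrite !big_ord_recl big_ord0 addn0 addnA.
apply: (@slice_rank_diagonal F #|A| {ffun 'I_n -> T} _ _
  (fun t => \prod_l c (t l)) (ex ord0) (ex o1) (ex o2) mon mon mon).
  move=> t.
  have : (\sum_k \sum_l ex k t l <= n * m)%N.
    rewrite exchange_big /= -[n in (n * m)%N]card_ord -sum_nat_const.
    apply: leq_sum => l _; apply: leq_trans (ele (t l)).
    by apply: leq_sum => k _; rewrite ffunE.
  rewrite sum3n !inE.
  move: (\sum_l ex ord0 t l)%N (\sum_l ex o1 t l)%N (\sum_l ex o2 t l)%N => s0 s1 s2.
  by case: leqP => //= h0; case: leqP => //= h1; case: leqP => //= h2; lia.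
move=> i j k.
pose x (r : 'I_3) := if r == ord0 then enum_val i else if r == o1 then enum_val j else enum_val k.
transitivity (\prod_(l < n) (1 - (\sum_r a r * x r 0 l) ^+ m)).
  rewrite (eq_bigr (fun l => \sum_t c t * \prod_r x r 0 l ^+ e t r)); last by move=> l _; apply: eE.
  rewrite bigA_distr_bigA; apply: eq_bigr => t _.
  rewrite big_split /= -!mulrA; congr (_ * _).
  rewrite exchange_big prod3 /= /mon mulrA; congr (_ * _ * _);
    by apply: eq_bigr => l _; rewrite ffunE.
rewrite (eq_bigr (fun l => (\sum_r a r * x r 0 l == 0)%:R)); last first.
  by move=> l _; rewrite finField_eq0_indicator.
transitivity (\prod_(l < n) ((\sum_r a r *: x r) 0 l == 0)%:R : F).
  apply: eq_bigr => l _; rewrite summxE; congr (_ == _)%:R.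
  by apply: eq_bigr => r _; rewrite mxE.
rewrite prod_row_eq0; congr (_%:R); congr (nat_of_bool _).
apply/eqP/andP=> [s0|[/eqP eij /eqP ejk]].
  have xA r : x r \in A by rewrite /x; case: ifP => _; [|case: ifP => _]; exact: enum_valP.
  have := triv x xA s0.
  by move=> H; split; apply/eqP/enum_val_inj; [exact: (H ord0 o1)|exact: (H o1 o2)].
rewrite (eq_bigr (fun r => a r *: enum_val i)) => [|r _]; first by rewrite -scaler_suml sa scale0r.
by rewrite /x -ejk -eij; case: ifP => // _; case: ifP.
Qed.

(** * Counting monomials of low degree *)

(** Rankin's trick: the right side is the sum of [t ^+ (3 * \sum_l s l)] over all [s], and each
    low-degree [s] contributes at least [t ^+ (n * m)] as [t <= 1]. *)
Lemma card_low_degree (R : realFieldType) (n m : nat) (t : R) :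
  0 < t -> t <= 1 ->
  #|low_degree n m|%:R * t ^+ (n * m) <= (\sum_(j < m.+1) t ^+ (3 * j)) ^+ n.
Proof.
move=> t0 t1.
rewrite -[X in _ <= _ ^+ X]card_ord -prodr_const bigA_distr_bigA /=.
rewrite mulr_natl -sumr_const [leRHS](bigID (mem (low_degree n m))) /=.
rewrite -[leLHS]addr0 lerD //; last first.
  by apply: sumr_ge0 => s _; apply: prodr_ge0 => l _; rewrite exprn_ge0 // ltW.
apply: ler_sum => s; rewrite inE => low.
rewrite prodrXr; apply: ler_wiXn2l; [exact: ltW|by []|].
by rewrite big_distrr /= in low.
Qed.

Lemma expr_bernoulli2 (R : realFieldType) (e : R) (k : nat) :
  0 <= e <= 1 -> 1 - k%:R * e <= (1 - e) ^+ k <= 1 - k%:R * e + (k%:R * e) ^+ 2.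
Proof.
move=> /andP[e0 e1]; elim: k => [|k /andP[l u]]; first by rewrite expr0; nra.
have k0 : 0 <= k%:R :> R by [].
rewrite exprSr -natr1; apply/andP; split.
  have : (1 - k%:R * e) * (1 - e) <= (1 - e) ^+ k * (1 - e) by rewrite ler_wpM2r // subr_ge0.
  by nra.
apply: (@le_trans _ _ ((1 - k%:R * e + (k%:R * e) ^+ 2) * (1 - e))).
  by rewrite ler_wpM2r // subr_ge0.
have : 0 <= k%:R * k%:R * e * e * e by rewrite !mulr_ge0.
by nra.
Qed.

(** At [t = 1] both sides equal [m.+1], with derivatives [3 / 2 * m * m.+1] and [m * m.+1]; so the
    left side is smaller just below 1. *)
Lemma power_sum_small (R : realFieldType) (m : nat) : (0 < m)%N ->
  exists t : R, [/\ 0 < t, t <= 1 & \sum_(j < m.+1) t ^+ (3 * j) < m.+1%:R * t ^+ m].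
Proof.
move=> m_gt0; have m1 : 1 <= m%:R :> R by rewrite ler1n.
(* For [t = 1 - e], after division by [m.+1], the first-order gain is [m * e / 2] and the quadratic
   error at most [9 * (m * e) ^+ 2]; any [m * e < 1 / 18] works. *)
pose e : R := (36 * m%:R)^-1.
have eE : 36 * m%:R * e = 1 by rewrite mulfV // mulf_neq0 ?pnatr_eq0 // -lt0n.
have e0 : 0 < e by rewrite invr_gt0; lra.
have e1 : e <= 36^-1 by nra.
have ge0le1 : 0 <= e <= 1 by apply/andP; split; lra.
exists (1 - e); split; [lra|lra|].
have le_sum k : (k <= m.+1)%N -> \sum_(j < k) (1 - e) ^+ (3 * j)
    <= k%:R * (1 + 9 * (m%:R * e) ^+ 2) - 3 / 2 * e * (k%:R * (k%:R - 1)).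
  elim: k => [|k IH] kq; first by rewrite big_ord0; lra.
  rewrite big_ord_recr /=.
  have /andP[_] := expr_bernoulli2 (3 * k) ge0le1.
  have := IH (ltnW kq).
  have : k%:R * k%:R <= m%:R * m%:R :> R by rewrite -!natrM ler_nat leq_mul.
  rewrite natrM -natr1; set A := \sum_(_ < _) _; set B := _ ^+ (3 * k).
  have : 0 <= e * e by rewrite mulr_ge0 ?ltW.
  by nra.
apply: le_lt_trans (le_sum _ (leqnn _)) _.
have /andP[] := expr_bernoulli2 m ge0le1.
rewrite -natr1; set B := _ ^+ m; nra.
Qed.

(** * Independent sets in sparse digraphs *)

(** By averaging, some [v] in [B] has at most [K] in-neighbours in [B]; select [v], delete it with
    its at most [2 * K] neighbours, and repeat. *)
Lemma digraph_independent_set (T : finType) (K : nat) (H : T -> {set T}) (B : {set T}) :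
  {in B, forall x, #|H x| <= K /\ x \notin H x}%N ->
  exists I : {set T}, [/\ I \subset B, (#|B| <= (2 * K).+1 * #|I|)%N &
    {in I &, forall x y, y \notin H x}].
Proof.
have [m] := ubnP #|B|; elim: m B => // m IH B Bm HB.
have [->|[v0 v0B]] := set_0Vmem B.
  by exists set0; split; rewrite ?sub0set ?cards0 // => x y; rewrite inE.
pose In v := [set x in B | v \in H x].
have [v vB vK] : exists2 v, v \in B & (#|In v| <= K)%N.
  apply/exists_inP; apply: contraT => /exists_inPn noV.
  have B_gt0 : (0 < #|B|)%N by apply/card_gt0P; exists v0.
  have : (#|B| * K.+1 <= \sum_(v in B) \sum_(x in B) (v \in H x))%N.
    rewrite -sum_nat_const; apply: leq_sum => v /noV; rewrite -ltnNge => /leq_trans; apply.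
    by rewrite -sum1dep_card big_mkcondr leq_sum // => x _; case: (v \in H x).
  have : (\sum_(v in B) \sum_(x in B) (v \in H x) <= #|B| * K)%N.
    rewrite exchange_big -sum_nat_const; apply: leq_sum => x /HB[HK _].
    apply: leq_trans HK; rewrite -sum1_card big_mkcond [leqRHS]big_mkcond.
    by apply: leq_sum => v _; case: (v \in B); case: (v \in H x).
  by move: (\sum_(_ in _) _)%N => S; nia.
pose D := v |: (H v :|: In v).
have [HvK vHv] := HB v vB.
have Dle : (#|D| <= (2 * K).+1)%N.
  rewrite cardsU1 (leq_trans (leq_add (leq_b1 _) (leqnn _))) // add1n ltnS.
  by rewrite (leq_trans (leq_card_setU _ _)) // mul2n -addnn leq_add.
have [| |I [IB BI Iind]] := IH (B :\: D).
- rewrite (leq_trans _ (_ : #|B| <= m)%N) //; apply: proper_card.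
  apply/properP; split; first exact: subsetDl.
  by exists v => //; rewrite !inE eqxx.
- by move=> x; rewrite inE => /andP[_]; exact: HB.
have vI : v \notin I by apply/negP => /(subsetP IB); rewrite !inE eqxx.
exists (v |: I); split.
- by rewrite subUset sub1set vB (subset_trans IB) ?subsetDl.
- rewrite cardsU1 vI mulnDr muln1 -(cardsID D B) leq_add //.
  by rewrite (leq_trans _ Dle) // subset_leq_card ?subsetIr.
- move=> x y; rewrite !inE => /predU1P[->|xI] /predU1P[->|yI] //.
  + by move/(subsetP IB): yI; rewrite !inE; case/andP => /norP[_ /norP[]].
  + by move/(subsetP IB): xI; rewrite !inE; case/andP => /norP[_ /norP[_]] /[swap] ->.
  + exact: Iind.
Qed.

(** * Exponential bounds and shortening of equations *)

Section Solutions.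
Variables (R : realType) (F : finFieldType).
Implicit Types (a : seq F) (n : nat).

(* Keeping each coefficient next to its variable makes solutions invariant
   under reordering of the equation. *)
Definition solution a n (A : {set 'rV[F]_n}) (s : seq (F * 'rV[F]_n)) :=
  [&& perm_eq (unzip1 s) a, uniq (unzip2 s), all [in A] (unzip2 s) &
      \sum_(p <- s) p.1 *: p.2 == 0].

(** A solution of the equation lengthened by minus the coefficient sum, with the extra variable [x]
    kept apart so that two halves can share it. *)
Definition pivot_solution a n (A : {set 'rV[F]_n}) (x : 'rV[F]_n)
    (s : seq (F * 'rV[F]_n)) :=
  [&& perm_eq (unzip1 s) a, uniq (unzip2 s), all [in A] (unzip2 s),
      x \notin unzip2 s & \sum_(p <- s) p.1 *: p.2 == (\sum_(b <- a) b) *: x].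

(** The factor [C] leaves room for adding bounds when equations are combined; it is absorbed into
    the base only at the end. *)
Definition exp_bound a (C c : R) :=
  [/\ 0 <= C, 0 < c, c < #|F|%:R &
      forall n (A : {set 'rV[F]_n}), (forall s, ~~ solution a A s) ->
        #|A|%:R <= C * c ^+ n].

Definition exp_bounded a := exists C c : R, exp_bound a C c.

Lemma exp_bounded_perm a a' : perm_eq a a' -> exp_bounded a -> exp_bounded a'.
Proof.
move=> aa' [C [c [C0 c0 cq H]]]; exists C, c; split=> // n A ns; apply: H => s.
by have := ns s; rewrite /solution (permPr aa').
Qed.

(** In a solution of the lengthened equation, the variable with the extra coefficient is a pivot for
    the others, so one of them lies in its blocking set. An independent set therefore contains no
    solution. *)
Lemma few_bad_pivots a (C c : R) n (A B : {set 'rV[F]_n}) (K : nat)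
    (H : 'rV[F]_n -> {set 'rV[F]_n}) :
  exp_bound (- (\sum_(b <- a) b) :: a) C c -> B \subset A ->
  {in B, forall x, #|H x| <= K /\ x \notin H x}%N ->
  {in B, forall x s, pivot_solution a A x s -> has [in H x] (unzip2 s)} ->
  #|B|%:R <= (2 * K).+1%:R * C * c ^+ n.
Proof.
move=> [C0 c0 cq bd] BA HB piv.
have [I [IB BI Iind]] := digraph_independent_set HB.
apply: (@le_trans _ _ ((2 * K).+1%:R * #|I|%:R)); first by rewrite -natrM ler_nat.
rewrite -mulrA ler_wpM2l //; apply: bd => s; apply/negP => /and4P[ps us /allP sI s0].
have /mapP[p p_in pE] : - (\sum_(b <- a) b) \in unzip1 s by rewrite (perm_mem ps) mem_head.
have sp := perm_to_rem p_in.
move: ps us s0; set s' := rem p s.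
rewrite (permPl (perm_map fst sp)) (perm_uniq (perm_map snd sp)) (perm_big _ sp) /=.
rewrite -pE perm_cons big_cons -pE => ps' /andP[p2 us'].
rewrite scaleNr addrC subr_eq0 => s0'.
have sI' y : y \in p.2 :: unzip2 s' -> y \in I.
  by move=> ys; apply: sI; rewrite (perm_mem (perm_map snd sp)).
have pI := sI' _ (mem_head _ _).
have /hasP[y ys yH] : has [in H p.2] (unzip2 s').
  apply: piv; first exact: (subsetP IB).
  apply/and5P; split=> //; apply/allP => y ys.
  by apply/(subsetP BA)/(subsetP IB)/sI'; rewrite inE ys orbT.
by have := Iind _ _ pI (sI' y _); rewrite inE ys orbT => /(_ isT)/negP; apply.
Qed.

Lemma exp_bounded_cat a1 a2 : \sum_(b <- a1 ++ a2) b = 0 ->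
  exp_bounded (- (\sum_(b <- a1) b) :: a1) ->
  exp_bounded (- (\sum_(b <- a2) b) :: a2) -> exp_bounded (a1 ++ a2).
Proof.
move=> s12 [C1 [c1 bd1]] [C2 [c2 bd2]].
have [C10 c10 c1q _] := bd1; have [C20 c20 c2q _] := bd2.
pose M := Num.max c1 c2.
have mono c n : 0 < c -> c <= M -> c ^+ n <= M ^+ n.
  by move=> c0 cM; rewrite lerXn2r // nnegrE ?(le_trans _ cM) // ltW.
pose K := size a1; pose L : R := (2 * K).+1%:R.
exists (C1 + L * C2), M; split.
- by rewrite addr_ge0 ?mulr_ge0.
- by rewrite lt_max c10.
- by rewrite gt_max c1q.
move=> n A nosol.
(* [B1] holds the points that are no pivot of the first half; empty blocking sets suffice for it. *)
pose B1 := [set x in A | ~~ `[< exists s, pivot_solution a1 A x s >]].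
pose B2 := A :\: B1.
have le1 : #|B1|%:R <= C1 * M ^+ n.
  have := @few_bad_pivots a1 C1 c1 n A B1 0 (fun=> set0) bd1.
  rewrite mul1r => le; apply: le_trans (le _ _ _) _.
  - by apply/subsetP => x; rewrite inE => /andP[].
  - by move=> x _; rewrite cards0 inE.
  - move=> x; rewrite inE => /andP[_ /asboolPn no] s ps.
    by case: no; exists s.
  by rewrite ler_wpM2l // mono // le_max lexx.
have /choice[H HP] (x : 'rV[F]_n) : exists Hx : {set 'rV[F]_n}, x \in B2 ->
    [/\ (#|Hx| <= K)%N, x \notin Hx &
        forall s, pivot_solution a2 A x s -> has [in Hx] (unzip2 s)].
  have [xB|] := boolP (x \in B2); last by exists set0.
  have /asboolP[s1 /and5P[p1 u1 A1 x1 /eqP e1]] : `[< exists s, pivot_solution a1 A x s >].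
    by move: xB; rewrite !inE => /andP[] /nandP[/negP //|/negPn].
  (* The variables of one fixed first half block [x]: a second half avoiding them would complete it
     to a solution in [A], since the multiples of [x] cancel. *)
  exists [set y in unzip2 s1] => _; split.
  - rewrite /K -(perm_size p1) !size_map cardsE.
    by rewrite (leq_trans (card_size _)) // size_map.
  - by rewrite inE.
  move=> s2 /and5P[p2 u2 A2 x2 /eqP e2]; apply: contraNT (nosol (s1 ++ s2)) => no.
  rewrite /solution /unzip1 /unzip2 !map_cat perm_cat // cat_uniq u1 u2 all_cat A1 A2 /=.
  rewrite big_cat /= e1 e2 -scalerDl -big_cat s12 scale0r eqxx !andbT.
  by apply: contra no => /hasP[y ys2 ys1]; apply/hasP; exists y; rewrite // inE.
have le2 : #|B2|%:R <= L * C2 * M ^+ n.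
  have := @few_bad_pivots a2 C2 c2 n A B2 K H bd2 => le; apply: le_trans (le _ _ _) _.
  - exact: subsetDl.
  - by move=> x /HP[].
  - by move=> x /HP[].
  by rewrite ler_wpM2l ?mulr_ge0 // mono // le_max lexx orbT.
rewrite mulrDl (le_trans _ (lerD le1 le2)) // -natrD ler_nat.
by rewrite -(cardsID B1 A) leq_add // subset_leq_card ?subsetIr.
Qed.

(** If two variables of a solution agree, the zero sum and the nonzero third coefficient force all
    three to agree, so [A] has only trivial solutions. *)
Lemma exp_bounded3 (a b c : F) : a != 0 -> b != 0 -> c != 0 -> a + b + c = 0 ->
  exp_bounded [:: a; b; c].
Proof.
move=> a0 b0 c0 abc; set m := #|F|.-1.
have q1 : (1 < #|F|)%N := finNzRing_gt1 F.
have mq : m.+1 = #|F| by rewrite prednK // ltnW.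
have [|t [t0 t1 small]] := @power_sum_small R m; first by rewrite -ltnS mq.
pose S : R := \sum_(j < m.+1) t ^+ (3 * j).
have tm0 : 0 < t ^+ m by rewrite exprn_gt0.
have S0 : 0 < S.
  rewrite /S big_ord_recl muln0 expr0 ltr_pwDl //.
  by apply: sumr_ge0 => j _; rewrite exprn_ge0 // ltW.
(* The base is below [#|F|] because [S < m.+1%:R * t ^+ m] and [m.+1 = #|F|]. *)
exists 3, (S / t ^+ m); split; rewrite ?divr_gt0 //.
  by rewrite ltr_pdivrMr // -mq.
move=> n A nosol.
have le3 : (#|A| <= 3 * #|low_degree n m|)%N.
  apply: (@card_trivial_solutions F n (fun i => nth 0 [:: a; b; c] i)).
    by rewrite !big_ord_recl big_ord0 /= addr0 addrA.
  move=> x xA; rewrite !big_ord_recl big_ord0 /= addr0.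
  set i1 := lift ord0 ord0; set i2 := lift ord0 (lift ord0 ord0) => s0.
  have [x01 x02] : x ord0 = x i1 /\ x ord0 = x i2.
    have cE : c = - (a + b) by apply/eqP; rewrite -addr_eq0 addrC abc.
    have aE : a = - (b + c) by apply/eqP; rewrite -addr_eq0 addrA abc.
    have bE : b = - (a + c) by apply/eqP; rewrite -addr_eq0 addrCA addrA abc.
    have [e|n01] := eqVneq (x ord0) (x i1).
      split=> //; apply/eqP; rewrite -subr_eq0.
      have : c *: (x ord0 - x i2) = 0.
        rewrite -[RHS]oppr0 -s0 -e addrA -scalerDl.
        have -> : a + b = - c by rewrite cE opprK.
        by rewrite scaleNr scalerBr opprD opprK.
      by move/eqP; rewrite scaler_eq0 (negPf c0).
    have [e|n02] := eqVneq (x ord0) (x i2).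
      split=> //; apply/eqP; rewrite -subr_eq0.
      have : b *: (x ord0 - x i1) = 0.
        rewrite -[RHS]oppr0 -s0 -e addrCA -scalerDl.
        have -> : a + c = - b by rewrite bE opprK.
        by rewrite scaleNr scalerBr opprD opprK addrC.
      by move/eqP; rewrite scaler_eq0 (negPf b0).
    have [e|n12] := eqVneq (x i1) (x i2).
      case/eqP: n01; apply/eqP; rewrite -subr_eq0.
      have : a *: (x ord0 - x i1) = 0.
        rewrite -s0 -e -scalerDl.
        have -> : b + c = - a by rewrite aE opprK.
        by rewrite scaleNr scalerBr.
      by move/eqP; rewrite scaler_eq0 (negPf a0).
    case/negP: (nosol [:: (a, x ord0); (b, x i1); (c, x i2)]).
    rewrite /solution /= perm_refl !inE !xA negb_or n01 n02 n12 /=.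
    by rewrite !big_cons big_nil /= addr0 s0.
  have H i : x i = x ord0.
    by case: i => [[|[|[|//]]] hi]; [|rewrite x01|rewrite x02]; congr (x _); apply: val_inj.
  by move=> i j; rewrite !H.
apply: (@le_trans _ _ (3 * #|low_degree n m|%:R)); first by rewrite -natrM ler_nat.
rewrite ler_wpM2l // expr_div_n ler_pdivlMr ?exprn_gt0 //.
by rewrite -exprM mulnC card_low_degree.
Qed.

(** Two different unordered pairs in [A] with the same sum [v != 0] give four distinct elements of
    sum [v + v = 0]. Otherwise each [v != 0] has at most two ordered representations, whence
    [#|A| ^ 2 <= 3 * #|F| ^ n]. *)
Lemma exp_bounded4_char2 (a : F) : a != 0 -> a + a = 0 ->
  exp_bounded [:: a; a; a; a].
Proof.
move=> a0 aa; set q : R := #|F|%:R.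
have q1 : 1 < q by rewrite ltr1n finNzRing_gt1.
have N1 : 1 + 1 = 0 :> F.
  by apply: (mulfI a0); rewrite mulrDr mulr1 aa mulr0.
exists 3, (Num.sqrt q); split=> //.
- by rewrite sqrtr_gt0; lra.
- rewrite -[X in _ < X]sqr_sqrtr; last by lra.
  have : 1 < Num.sqrt q by rewrite -[X in X < _]sqrtr1 ltr_sqrt; lra.
  by nra.
move=> n A nosol.
have char2 (v : 'rV[F]_n) : v + v = 0 by rewrite -[v]scale1r -scalerDl N1 scale0r.
pose fib v := [set y in A | v - y \in A].
have fib2 v : v != 0 -> (#|fib v| <= 2)%N.
  move=> v0; have [->|[y yf]] := set_0Vmem (fib v); first by rewrite cards0.
  suff : fib v \subset [set y; v - y].
    by move=> /subset_leq_card le; rewrite (leq_trans le) // cards2; case: eqP.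
  apply/subsetP => z zf; rewrite !inE; apply: contraT => /norP[zy zvy].
  move: yf zf; rewrite !inE => /andP[yA vyA] /andP[zA vzA].
  have ne u : u != v - u by rewrite -subr_eq0 opprB addrA char2 add0r oppr_eq0.
  case/negP: (nosol [:: (a, y); (a, v - y); (a, z); (a, v - z)]).
  rewrite /solution /= perm_refl !inE yA vyA zA vzA !negb_or !ne /= !andbT.
  have yvz : y != v - z by apply: contra zvy => /eqP ->; rewrite subKr.
  rewrite eq_sym zy yvz [v - y == z]eq_sym zvy (inj_eq (can_inj (subKr v))) eq_sym zy /=.
  rewrite !big_cons big_nil /= addr0 addrA -!scalerDr ![_ + (v - _)]addrC !subrK.
  by rewrite char2 scaler0.
have cardV : #|'rV[F]_n| = (#|F| ^ n)%N by rewrite card_mx mul1n.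
have sq : (#|A| * #|A| <= 3 * #|F| ^ n)%N.
  have -> : (#|A| * #|A| = \sum_v #|fib v|)%N.
    rewrite -sum_nat_const.
    rewrite [RHS](eq_bigr (fun v : 'rV[F]_n => \sum_(y in A) ((v - y)%R \in A))%N); last first.
      by move=> v _; rewrite /fib -sum1dep_card big_mkcondr; apply: eq_bigr => y _; case: (_ \in A).
    rewrite exchange_big; apply: eq_bigr => y _.
    rewrite (reindex_inj (addIr y)) /= -sum1_card big_mkcond.
    by apply: eq_bigr => v _; rewrite addrK; case: (_ \in A).
  (* The fibre over 0 has at most [#|F| ^ n] elements, every other fibre at most 2. *)
  rewrite (bigD1 0) //= -cardV (_ : 3 = 1 + 2)%N // mulnDl leq_add //.
    by rewrite mul1n max_card.
  rewrite mulnC -sum_nat_const.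
  rewrite [leqRHS](bigD1 0) //= (leq_trans _ (leq_addl _ _)) //.
  by apply: leq_sum => v; exact: fib2.
rewrite -ler_sqr ?nnegrE ?mulr_ge0 ?exprn_ge0 ?sqrtr_ge0 //.
rewrite exprMn -exprM mulnC exprM sqr_sqrtr; last by lra.
have : (#|A|%:R : R) ^+ 2 <= 3 * q ^+ n by rewrite expr2 /q -natrX -!natrM ler_nat.
have : 0 <= q ^+ n by rewrite exprn_ge0 //; lra.
nra.
Qed.

Lemma exp_bounded_zero_sum a : (3 <= size a)%N -> all (fun b => b != 0) a ->
  \sum_(b <- a) b = 0 -> exp_bounded a.
Proof.
have [m] := ubnP (size a); elim: m a => // m IH a.
(* Splitting off [x] and [y] leaves an equation of length three and one that is one shorter than the
   original. *)
have pair (x y : F) r : x + y != 0 -> (size r < m.-1)%N -> (2 <= size r)%N ->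
    all (fun b => b != 0) [:: x, y & r] -> \sum_(b <- [:: x, y & r]) b = 0 ->
    exp_bounded [:: x, y & r].
  move=> xy rm r2 /and3P[x0 y0 r0] s0.
  have rE : \sum_(b <- r) b = - (x + y).
    by apply/eqP; rewrite -addr_eq0 addrC -addrA; move: s0; rewrite !big_cons => ->.
  apply: (@exp_bounded_cat [:: x; y] r) => //.
    rewrite !big_cons big_nil addr0; apply: exp_bounded3 => //; first by rewrite oppr_eq0.
    by rewrite -addrA addNr.
  apply: IH; rewrite /=; [lia|lia| |].
    by rewrite rE opprK xy.
  by rewrite big_cons addNr.
case: a => [|x [|y [|z [|w r]]]] //= sz _ /and4P[x0 y0 z0 wr0] s0.
  by apply: exp_bounded3 => //; rewrite -s0 !big_cons big_nil addr0 addrA.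
have /andP[w0 r0] := wr0.
(* Four coefficients are enough to test: if [x + y], [x + z], [y + z] and [x + w] vanish, then
   [x + x = 0] and all four equal [x]. *)
have [xy|xy] := eqVneq (x + y) 0; last first.
  by apply: pair => //=; [lia|rewrite x0 y0 z0].
have via (u v : F) t : u + v != 0 -> perm_eq [:: u, v & t] [:: x, y, z, w & r] ->
    exp_bounded [:: x, y, z, w & r].
  move=> uv tE; have tsz : size t = (size r).+2 by case: (perm_size tE).
  apply: (exp_bounded_perm tE); apply: pair => //; rewrite ?tsz; [lia|lia| |].
    by rewrite (perm_all _ tE) /= x0 y0 z0.
  by rewrite (perm_big _ tE).
have [xz|xz] := eqVneq (x + z) 0; last first.
  by apply: (via x z [:: y, w & r]) => //; apply/permP => p /=; lia.
have [yz|yz] := eqVneq (y + z) 0; last first.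
  by apply: (via y z [:: x, w & r]) => //; apply/permP => p /=; lia.
have [xw|xw] := eqVneq (x + w) 0; last first.
  by apply: (via x w [:: y, z & r]) => //; apply/permP => p /=; lia.
have xx : x + x = 0.
  rewrite (_ : x + x = (x + y) + (x + z) - (y + z)); last by ring.
  by rewrite xy xz yz; ring.
have neg u : x + u = 0 -> u = x.
  by move=> xu; apply: (addrI x); rewrite xu xx.
rewrite (neg y) // (neg z) // (neg w) // in s0 *.
case: r r0 s0 {pair via wr0} sz => [|u r] r0 s0 sz; first exact: exp_bounded4_char2.
(* Three copies of [x] sum to [- x], so the first half lengthens to four copies of [x]; the second,
   with [- x] added, is two shorter than the original. *)
have x3 : \sum_(b <- [:: x; x; x]) b = - x.
  by rewrite !big_cons big_nil addr0 xx addr0; apply/eqP; rewrite -addr_eq0 xx.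
apply: (@exp_bounded_cat [:: x; x; x] [:: x, u & r]) => //.
  by rewrite x3 opprK; exact: exp_bounded4_char2.
have rE : \sum_(b <- [:: x, u & r]) b = x.
  apply/eqP; rewrite -subr_eq0 addrC -x3 -big_cat; exact/eqP.
apply: IH => //=; first by move: sz => /=; lia.
  by rewrite rE oppr_eq0 x0.
by rewrite big_cons rE addNr.
Qed.

End Solutions.

(** * Absorbing the constant and returning to indexed variables *)

(* F_q is any finite field F, with q = #|F| (a prime power automatically). *)
Theorem theorem2 (R : realType) (F : finFieldType) (d : nat) (hd : (4 <= d)%N)
    (a : 'I_d -> F) (ha : forall i, a i != 0) (hsum : \sum_(i < d) a i = 0) :
  exists c : R, c < (#|F|%:R : R) /\
    exists N : nat, forall n : nat, (N <= n)%N ->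
      forall A : {set 'rV[F]_n}, c ^+ n < (#|A|%:R : R) ->
        exists x : 'I_d -> 'rV[F]_n,
          [/\ injective x, (forall i, x i \in A) &
              \sum_(i < d) a i *: x i = 0].
Proof.
pose cs := [seq a i | i <- enum 'I_d].
have szcs : size cs = d by rewrite size_map size_enum_ord.
have [|||C [c0 [C0 c00 c0q bd]]] := @exp_bounded_zero_sum R F cs.
- by rewrite szcs ltnW.
- by apply/allP => _ /mapP[i _ ->].
- by rewrite big_map big_enum.
(* The midpoint of [c0] and [#|F|] absorbs [C]: [c / c0 = 1 + e], and Bernoulli gives
   [(1 + e) ^+ n >= 1 + n%:R * e >= C] once [n] exceeds [C / e]. *)
pose c := (c0 + #|F|%:R) / 2; pose e := c / c0 - 1.
have c0c : c0 < c by rewrite /c; lra.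
have e0 : 0 < e by rewrite subr_gt0 ltr_pdivlMr // mul1r.
exists c; split; first by rewrite /c; lra.
exists (Num.bound (C / e)) => n Nn A cA.
have Cc : C * c0 ^+ n <= c ^+ n.
  have cE : c = c0 * (1 + e) by rewrite /e addrC subrK mulrC divfK ?gt_eqF.
  rewrite cE exprMn mulrC ler_pM2l ?exprn_gt0 //.
  have bern k : 1 + k%:R * e <= (1 + e) ^+ k.
    elim: k => [|k IH]; first by rewrite expr0; lra.
    rewrite exprS -natr1; have : 0 <= k%:R * e * e by rewrite !mulr_ge0 // ltW.
    have : (1 + e) * (1 + k%:R * e) <= (1 + e) * (1 + e) ^+ k.
      by rewrite ler_pM2l //; lra.
    by lra.
  apply: le_trans (bern n); have : C / e < n%:R.
    apply: lt_le_trans (archi_boundP _) _; first by rewrite divr_ge0 // ltW.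
    by rewrite ler_nat.
  by rewrite ltr_pdivrMr // => ?; lra.
have [s] : exists s, solution cs A s.
  apply: contrapT => /forallNP no; have := bd n A (fun s => introN idP (no s)).
  by move/(lt_le_trans cA); rewrite ltNge Cc.
case/and4P=> ps us sA /eqP s0.
(* [Is] sends each index [i] to its own position in [s] carrying the coefficient [a i], also when
   coefficients repeat; the default [(0, 0)] is never reached. *)
have /(perm_iotaP 0)[Is pIs csE] : perm_eq cs (unzip1 s) by rewrite perm_sym.
have szIs : size Is = d by rewrite -szcs csE size_map.
have szs : size s = d by rewrite -(size_map fst) (perm_size ps).
pose p i := nth (0, 0) s (nth 0%N Is i).
have Islt (i : 'I_d) : (nth 0%N Is i < size s)%N.
  have : nth 0%N Is i \in Is by rewrite mem_nth // szIs.
  by rewrite (perm_mem pIs) size_map mem_iota.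
have p2E (i : 'I_d) : (p i).2 = nth 0 (unzip2 s) (nth 0%N Is i).
  by rewrite (nth_map (0, 0)).
have p1E (i : 'I_d) : (p i).1 = a i.
  transitivity (nth 0 cs i); last by rewrite (nth_map i) ?size_enum_ord // nth_ord_enum.
  by rewrite csE (nth_map 0%N) ?szIs // (nth_map (0, 0)).
exists (fun i : 'I_d => (p i).2); split.
- move=> i j; rewrite !p2E => /eqP; rewrite nth_uniq ?size_map // => /eqP /eqP.
  rewrite nth_uniq ?szIs // ?(perm_uniq pIs) ?iota_uniq // => /eqP; exact: val_inj.
- by move=> i; apply: (allP sA); rewrite p2E mem_nth // size_map.
(* The sum over [s] is a sum over its positions, reordered along [Is]. *)
- rewrite -[RHS]s0 -[s in RHS](mkseq_nth (0, 0)) big_map.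
  rewrite -[in RHS](size_map fst) -(perm_big _ pIs) /=.
  rewrite [RHS](big_nth 0%N) szIs big_mkord; apply: eq_bigr => i _.
  by rewrite -p1E.
Qed.
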